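(* Let $k\ge1$ and let $(a,b)\in P_+^k\setminus\mathcal{J}_3$. Let $(i,j),(m,n)\in\mathcal{R}^{(1);k}_{(a,b),(b,a)}$ with $(i,j)\notin\mathcal{J}_3$ and $(m,n)\notin\mathcal{J}_3$. Then $$\dim\operatorname{Hom}\big((a,b)\times(b,a)\times(i,j)\times(m,n),(0,0)\big)>1 .$$
   Context: $\widehat{\mathfrak{su}}(3)_k$ fusion. Fix an integer $k\ge1$ and let $P_+^k=\{(\lambda_1,\lambda_2)\in\mathbb{Z}_{\ge0}^2:\lambda_1+\lambda_2\le k\}$. The conjugate of $(x,y)$ is $(y,x)$. For $\lambda,\mu,\nu\in P_+^k$ set - $\mathcal{A}=\tfrac13[2(\lambda_1+\mu_1+\nu_2)+\lambda_2+\mu_2+\nu_1]$, - $\mathcal{B}=\tfrac13[\lambda_1+\mu_1+\nu_2+2(\lambda_2+\mu_2+\nu_1)]$, - $k_0^{\max}=\min(\mathcal{A},\mathcal{B})$, - $k_0^{\min}=\max(\lambda_1+\lambda_2,\mu_1+\mu_2,\nu_1+\nu_2,\mathcal{A}-\lambda_1,\mathcal{A}-\mu_1,\mathcal{A}-\nu_2,\mathcal{B}-\lambda_2,\mathcal{B}-\mu_2,\mathcal{B}-\nu_1)$. The fusion multiplicity is $N^{(k)\nu}_{\lambda,\mu}=\min(k_0^{\max},k)-k_0^{\min}+1$ if $\mathcal{A},\mathcal{B}$ are nonnegative integers, $k_0^{\max}\ge k_0^{\min}$ and $k\ge k_0^{\min}$; otherwise $N^{(k)\nu}_{\lambda,\mu}=0$.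 The fusion ring is the free abelian group on $P_+^k$ with the commutative, associative product $\lambda\times\mu=\sum_\nu N^{(k)\nu}_{\lambda,\mu}\,\nu$ and unit $(0,0)$. For $x_1,\dots,x_n\in P_+^k$, $\dim\operatorname{Hom}(x_1\times\cdots\times x_n,(0,0))$ denotes the coefficient of $(0,0)$ in $x_1\times\cdots\times x_n$. Further notation: - $\mathcal{R}^k_{\lambda,\mu}=\{\nu:N^{(k)\nu}_{\lambda,\mu}\ne0\}$; - $\mathcal{R}^{(1);k}_{\lambda,\mu}=\{\nu:N^{(k)\nu}_{\lambda,\mu}=1\}$; - the simple currents are $\mathcal{J}_3=\{(0,0),(k,0),(0,k)\}$. *)

(* Defs.v *)
From mathcomp Require Import all_boot.
Set Implicit Arguments. Unset Strict Implicit. Unset Printing Implicit Defensive.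

(* Weights of su(3)_k are pairs (x1, x2) of naturals. *)
Definition weight := (nat * nat)%type.

Definition in_Pplus (k : nat) (l : weight) : bool := l.1 + l.2 <= k.

Definition Pplus (k : nat) : seq weight :=
  [seq (x, y) | x <- iota 0 k.+1, y <- iota 0 (k.+1 - x)].

Definition conjw (l : weight) : weight := (l.2, l.1).

Definition simple_current (k : nat) (l : weight) : bool :=
  (l == (0, 0)) || (l == (k, 0)) || (l == (0, k)).

Definition A3 (l m n : weight) : nat := 2 * (l.1 + m.1 + n.2) + l.2 + m.2 + n.1.
Definition B3 (l m n : weight) : nat := l.1 + m.1 + n.2 + 2 * (l.2 + m.2 + n.1).

(* Fusion multiplicity N^{(k) nu}_{lambda, mu}.  When 3 | A3 and 3 | B3, the
   quantities A = A3/3 and B = B3/3 are exact, and A - l1, A - m1, A - n2,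
   B - l2, B - m2, B - n1 are nonnegative (so truncated subtraction is exact). *)
Definition fusion_mult (k : nat) (l m n : weight) : nat :=
  let A := A3 l m n %/ 3 in
  let B := B3 l m n %/ 3 in
  let kmax := minn A B in
  let kmin := maxn (l.1 + l.2) (maxn (m.1 + m.2) (maxn (n.1 + n.2)
              (maxn (A - l.1) (maxn (A - m.1) (maxn (A - n.2)
              (maxn (B - l.2) (maxn (B - m.2) (B - n.1)))))))) in
  if [&& 3 %| A3 l m n, 3 %| B3 l m n, kmin <= kmax & kmin <= k]
  then minn kmax k - kmin + 1 else 0.

(* Elements of the fusion ring with nonnegative coefficients, as coefficient
   functions on weights (only the values on P_+^k matter). *)
Definition fvec := weight -> nat.

Definition basis (l : weight) : fvec := fun n => (n == l : nat).

Definition fmul_basis (k : nat) (v : fvec) (mu : weight) : fvec :=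
  fun nu => \sum_(l <- Pplus k) v l * fusion_mult k l mu nu.

(* x_1 x ... x x_n (left bracketed; the product is associative). *)
Definition fusion_prod (k : nat) (x1 : weight) (xs : seq weight) : fvec :=
  foldl (fmul_basis k) (basis x1) xs.

Definition hom_dim (k : nat) (x1 : weight) (xs : seq weight) : nat :=
  fusion_prod k x1 xs (0, 0).

(* Main.v *)
Require Import Defs.
From mathcomp Require Import all_boot zify.

(* By charge conjugation and simple-current symmetry, the multiplicity of a
   weight (q + 3d, q) or (q, q + 3d) in (a,b) x (b,a) depends only on the sorted
   triple x <= y <= z of {a, b, k - a - b}: it equals
     1 + min(q, x - d, x + y - q - 2d, k - 2q - 3d)
   when this is positive.  So for u = (i,j) and v = (m,n), of multiplicity one, one
   of the four terms vanishes.  The dimension of the Hom space is at least the sum over l of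
   N_{(a,b),(b,a)}^l N_{l,u}^{v*}.  When the Parthasarathy-Ranga Rao-Varadarajan
   component of u x v is present in (a,b) x (b,a), its conjugate contributes; a
   second channel is a neighbour of it in a root direction, unless its own
   multiplicity in (a,b) x (b,a) is already at least 2.  Otherwise u and v are
   of the same orientation and far apart, and two other neighbouring weights, or
   a single one with multiplicity 2, play the same role. *)

(** * Fusion multiplicities as linear inequalities *)

(** A nonzero multiplicity is [min(A, B, k) - kmin + 1], so a threshold [g > 0] splits into one
    inequality for each entry of the maximum and each of [A], [B], [k]. *)
Lemma fusion_mult_geP k g l m n A B :
  A3 l m n = 3 * A -> B3 l m n = 3 * B -> 0 < g ->
  (g <= fusion_mult k l m n) =
  all (fun c => [&& c + g <= A.+1, c + g <= B.+1 & c + g <= k.+1])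
    [:: l.1 + l.2; m.1 + m.2; n.1 + n.2; A - l.1; A - m.1; A - n.2;
        B - l.2; B - m.2; B - n.1].
Proof.
have aux K M : 0 < g -> (g <= if (K <= M) && (K <= k) then minn M k - K + 1 else 0)
    = (K + g <= (minn M k).+1).
  by case: (leqP K M); case: (leqP K k) => /= *; apply/idP/idP; lia.
move=> hA hB g_gt0; rewrite /fusion_mult hA hB !mulKn // !dvdn_mulr //= aux //.
by rewrite !addn_maxl !geq_max -!minnSS !leq_min -!andbA andbT.
Qed.

(** Conjugation exchanges [A3] and [B3], hence two blocks of three in the maximum, which [mx] swaps
    back. *)
Lemma fusion_mult_conj k l m n :
  fusion_mult k (conjw l) (conjw m) (conjw n) = fusion_mult k l m n.
Proof.
have eA : A3 (conjw l) (conjw m) (conjw n) = B3 l m n by rewrite /A3 /B3 /=; lia.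
have eB : B3 (conjw l) (conjw m) (conjw n) = A3 l m n by rewrite /A3 /B3 /=; lia.
have mx a b c d e f : maxn a (maxn b (maxn c (maxn d (maxn e f)))) =
                      maxn d (maxn e (maxn f (maxn a (maxn b c)))).
  by rewrite !maxnA [RHS]maxnC !maxnA [RHS]maxnC -!maxnA maxnC -!maxnA.
rewrite /fusion_mult eA eB; move: (A3 l m n) (B3 l m n) => a b.
rewrite andbCA [minn (b %/ 3) _]minnC; move: (a %/ 3) (b %/ 3) => A B.
by rewrite ![(conjw _).1 + _]addnC [maxn (B - (conjw l).1) _]mx.
Qed.

(** * Two-channel certificates and multiplicity profiles *)

Definition two_channels (N1 N2 : weight -> nat) :=
  (exists l, 2 <= N1 l /\ 1 <= N2 l) \/
  (exists l l', [/\ l <> l', 1 <= N1 l, 1 <= N2 l, 1 <= N1 l' & 1 <= N2 l']).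

(* [star k x y g q d]: the multiplicity formula of the header is at least [g],
   rewritten without subtractions. *)
Definition star k x y g q d :=
  [&& g <= q.+1, d + g <= x.+1, q + 2 * d + g <= (x + y).+1 & 2 * q + 3 * d + g <= k.+1].

Definition extremal k x y q d := star k x y 1 q d && ~~ star k x y 2 q d.

Definition star_profile k x y (N : weight -> nat) :=
  forall g q d, 0 < g -> (g <= N (q + 3 * d, q)) = star k x y g q d /\
                         (g <= N (q, q + 3 * d)) = star k x y g q d.

Lemma extremalE k x y q d : extremal k x y q d ->
  (d <= x /\ q + 2 * d <= x + y /\ 2 * q + 3 * d <= k) /\
  (q = 0 \/ d = x \/ q + 2 * d = x + y \/ 2 * q + 3 * d = k).
Proof. by rewrite /extremal /star => h; lia. Qed.

Lemma starP k x y g q d :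
  if star k x y g q d then
    g <= q.+1 /\ d + g <= x.+1 /\ q + 2 * d + g <= (x + y).+1 /\ 2 * q + 3 * d + g <= k.+1
  else
    q.+1 < g \/ x.+1 < d + g \/ (x + y).+1 < q + 2 * d + g \/ k.+1 < 2 * q + 3 * d + g.
Proof. by rewrite /star; case: ifP => h; lia. Qed.

Lemma fusion_mult_gt0 k l1 l2 m1 m2 n1 n2 A B :
  2 * (l1 + m1 + n2) + l2 + m2 + n1 = 3 * A ->
  l1 + m1 + n2 + 2 * (l2 + m2 + n1) = 3 * B ->
  all (fun c => [&& c <= A, c <= B & c <= k])
    [:: l1 + l2; m1 + m2; n1 + n2; A - l1; A - m1; A - n2; B - l2; B - m2; B - n1] ->
  1 <= fusion_mult k (l1, l2) (m1, m2) (n1, n2).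
Proof.
move=> hA hB; rewrite (@fusion_mult_geP k 1 (l1, l2) (m1, m2) (n1, n2) A B hA hB) //.
by rewrite (@eq_all _ _ (fun c => [&& c <= A, c <= B & c <= k])) // => c; rewrite !addn1.
Qed.

(* The disjunctions are rarely needed and make [lia] slow. *)
Ltac dlia :=
  first [solve [repeat match goal with H : _ \/ _ |- _ => clear H end; lia] | lia].

Ltac solve_gt0 A B := apply: (@fusion_mult_gt0 _ _ _ _ _ _ _ A B);
  [lia | lia | rewrite /= ?andbT; repeat (apply/andP; split); dlia].

Ltac solve_star H :=
  first [rewrite (H _ _ _ (ltn0Sn _)).1 | rewrite (H _ _ _ (ltn0Sn _)).2];
  rewrite /star; repeat (apply/andP; split); dlia.

Ltac one_witness H l A B :=
  left; exists l; split; [solve_star H | solve_gt0 A B].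

Ltac two_witnesses H l A B l' A' B' :=
  right; exists l, l'; split;
    [case; dlia | solve_star H | solve_gt0 A B | solve_star H | solve_gt0 A' B'].

(** * Channels for each relative position of u and v *)

(* In the lemmas below u = (q + 3d, q), and [opposite] or [parallel] says whether
   v is (h, h + 3e) or (h + 3e, h).  The cases depend on the Weyl chamber of the
   difference v - u* and on its orientation; the conjugate of its dominant
   representative is the first witness.  Each witness is followed by its values
   of A and B. *)
Section Channels.
Variables (k x y : nat) (N : weight -> nat).
Hypotheses (lexy : x <= y) (leyk : x + 2 * y <= k) (y_gt0 : 0 < y).
Hypothesis NP : star_profile k x y N.

Lemma opposite_up q d e h t w :
  0 < q + d -> (q = 0 -> 3 * d < k) -> (h = 0 -> 3 * e < k) ->
  e = d + t -> h = q + w ->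
  extremal k x y q d -> extremal k x y h e ->
  two_channels N (fun l => fusion_mult k l (q + 3 * d, q) (h + 3 * e, h)).
Proof.
move=> qd_gt0 qd_ltk he_ltk ed eh /extremalE[[a1 [a2 a3]] a4] /extremalE[[b1 [b2 b3]] b4].
have := starP k x y 2 w t; case: ifP => _ N2.
  one_witness NP (w + 3 * t, w)
    (q + 2 * d + h + e + (w + 2 * t)) (q + d + h + 2 * e + (w + t)).
(* The second witness is the first plus the highest root (1,1). *)
two_witnesses NP (w + 3 * t, w)
    (q + 2 * d + h + e + (w + 2 * t)) (q + d + h + 2 * e + (w + t))
  (w.+1 + 3 * t, w.+1)
    (q + 2 * d + h + e + (w + 2 * t).+1) (q + d + h + 2 * e + (w + t).+1).
Qed.

Lemma opposite_down1 q d e h t w :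
  0 < q + d -> (q = 0 -> 3 * d < k) -> (h = 0 -> 3 * e < k) -> 0 < t ->
  d = e + t -> h = q + 3 * t + w ->
  extremal k x y q d -> extremal k x y h e ->
  two_channels N (fun l => fusion_mult k l (q + 3 * d, q) (h + 3 * e, h)).
Proof.
move=> qd_gt0 qd_ltk he_ltk t_gt0 ed eh /extremalE[[a1 [a2 a3]] a4] /extremalE[[b1 [b2 b3]] b4].
have := starP k x y 2 w t; case: ifP => _ N2.
  one_witness NP (w, w + 3 * t)
    (q + 2 * d + h + e + (w + t)) (q + d + h + 2 * e + (w + 2 * t)).
(* Here the second witness adds the simple root (2,-1). *)
two_witnesses NP (w, w + 3 * t)
    (q + 2 * d + h + e + (w + t)) (q + d + h + 2 * e + (w + 2 * t))
  (w.+2, w.+2 + 3 * t.-1)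
    (q + 2 * d + h + e + (w + t).+1) (q + d + h + 2 * e + (w + 2 * t)).
Qed.

Lemma opposite_down2 q d e h m w :
  0 < q + d -> (q = 0 -> 3 * d < k) -> (h = 0 -> 3 * e < k) -> 0 < w ->
  d = e + (m + w) -> h = q + (2 * (m + w) + m) ->
  extremal k x y q d -> extremal k x y h e ->
  two_channels N (fun l => fusion_mult k l (q + 3 * d, q) (h + 3 * e, h)).
Proof.
move=> qd_gt0 qd_ltk he_ltk w_gt0 ed eh /extremalE[[a1 [a2 a3]] a4] /extremalE[[b1 [b2 b3]] b4].
(* Multiplicity 2 is automatic: [0 < w], [m < d <= x], then [w + 2 * m < x + y] as [m + w <= d], and
   [2 * w + 3 * m <= h < k]. *)
one_witness NP (w, w + 3 * m)
    (q + 2 * d + h + e + (w + m)) (q + d + h + 2 * e + (w + 2 * m)).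
Qed.

Lemma opposite_down3 q d e h m w :
  0 < q + d -> (q = 0 -> 3 * d < k) -> (h = 0 -> 3 * e < k) -> 0 < w ->
  d = e + (m + 2 * w) -> h = q + (2 * (m + w) + w) ->
  extremal k x y q d -> extremal k x y h e ->
  two_channels N (fun l => fusion_mult k l (q + 3 * d, q) (h + 3 * e, h)).
Proof.
move=> qd_gt0 qd_ltk he_ltk w_gt0 ed eh /extremalE[[a1 [a2 a3]] a4] /extremalE[[b1 [b2 b3]] b4].
have := starP k x y 2 m w; case: ifP => _ N2.
  one_witness NP (m + 3 * w, m)
    (q + 2 * d + h + e + (m + 2 * w)) (q + d + h + 2 * e + (m + w)).
two_witnesses NP (m + 3 * w, m)
    (q + 2 * d + h + e + (m + 2 * w)) (q + d + h + 2 * e + (m + w))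
  (m.+1 + 3 * w, m.+1)
    (q + 2 * d + h + e + (m + 2 * w).+1) (q + d + h + 2 * e + (m + w).+1).
Qed.

Lemma parallel_large q d e h w :
  0 < q + d -> (q = 0 -> 3 * d < k) -> (h = 0 -> 3 * e < k) ->
  h = q + 3 * d + w ->
  extremal k x y q d -> extremal k x y h e ->
  two_channels N (fun l => fusion_mult k l (q + 3 * d, q) (h, h + 3 * e)).
Proof.
move=> qd_gt0 qd_ltk he_ltk eh /extremalE[[a1 [a2 a3]] a4] /extremalE[[b1 [b2 b3]] b4].
have := starP k x y 2 w (d + e); case: ifP => _ N2.
  one_witness NP (w, w + 3 * (d + e))
    (q + 2 * d + h + 2 * e + (w + (d + e))) (q + d + h + e + (w + 2 * (d + e))).
(* [d] steps along the root (2,-1) lower the parameter [d + e] of the first candidate, which may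
   exceed [x], to [e <= x]. *)
have := starP k x y 2 (w + 2 * d) e; case: ifP => _ N2'.
  one_witness NP (w + 2 * d, w + 2 * d + 3 * e)
    (q + 2 * d + h + 2 * e + (w + 2 * d + e)) (q + d + h + e + (w + 2 * d + 2 * e)).
have := starP k x y 1 w (d + e); case: ifP => _ N1.
  two_witnesses NP (w, w + 3 * (d + e))
    (q + 2 * d + h + 2 * e + (w + (d + e))) (q + d + h + e + (w + 2 * (d + e)))
    (w.+1, w.+1 + 3 * (d + e))
    (q + 2 * d + h + 2 * e + (w + (d + e)).+1) (q + d + h + e + (w + 2 * (d + e)).+1).
(* The other bounds of [star] follow from those on v, so only this one can fail; with [d <= x] it
   gives [0 < e]. *)
have x_lt_de : x < d + e by lia.
clear N1 N2.
two_witnesses NP (w + 2 * d, w + 2 * d + 3 * e)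
    (q + 2 * d + h + 2 * e + (w + 2 * d + e)) (q + d + h + e + (w + 2 * d + 2 * e))
    ((w + 2 * d).+2, (w + 2 * d).+2 + 3 * e.-1)
    (q + 2 * d + h + 2 * e + (w + 2 * d + e).+1) (q + d + h + e + (w + 2 * d + 2 * e)).
Qed.

Lemma parallel_middle q d e h w m :
  0 < q + d -> (q = 0 -> 3 * d < k) -> (h = 0 -> 3 * e < k) -> 0 < m ->
  d + e = w + m -> h + m = q + 3 * d ->
  extremal k x y q d -> extremal k x y h e ->
  two_channels N (fun l => fusion_mult k l (q + 3 * d, q) (h, h + 3 * e)).
Proof.
move=> qd_gt0 qd_ltk he_ltk m_gt0 ed eh /extremalE[[a1 [a2 a3]] a4] /extremalE[[b1 [b2 b3]] b4].
have := starP k x y 2 m w; case: ifP => _ N2.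
  one_witness NP (m, m + 3 * w)
    (q + 2 * d + h + 2 * e + (m + w)) (q + d + h + e + (m + 2 * w)).
have := starP k x y 1 m w; case: ifP => _ N1.
  two_witnesses NP (m, m + 3 * w)
    (q + 2 * d + h + 2 * e + (m + w)) (q + d + h + e + (m + 2 * w))
    (m.+2, m.+2 + 3 * w.-1)
    (q + 2 * d + h + 2 * e + (m + w).+1) (q + d + h + e + (m + 2 * w)).
have x_lt_w : x < w by lia.
clear N1 N2.
(* As [e <= x < w], the candidate moves [w - e] steps along (2,-1), which lowers its parameter [w]
   to [e]. *)
have [n en] : exists n, n + e = d + w by exists (d + w - e); lia.
two_witnesses NP (n, n + 3 * e)
    (q + 2 * d + h + 2 * e + (n + e)) (q + d + h + e + (n + 2 * e))
    (n.+2, n.+2 + 3 * e.-1)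
    (q + 2 * d + h + 2 * e + (n + e).+1) (q + d + h + e + (n + 2 * e)).
Qed.

Lemma parallel_small q d e h s w m :
  0 < q + d -> (q = 0 -> 3 * d < k) -> (h = 0 -> 3 * e < k) -> 0 < w -> d = s + w ->
  s + e = w + m -> h + m = q + 3 * s ->
  extremal k x y q d -> extremal k x y h e ->
  two_channels N (fun l => fusion_mult k l (q + 3 * d, q) (h, h + 3 * e)).
Proof.
move=> qd_gt0 qd_ltk he_ltk w_gt0 es ed eh /extremalE[[a1 [a2 a3]] a4] /extremalE[[b1 [b2 b3]] b4].
have := starP k x y 2 m w; case: ifP => _ N2.
  one_witness NP (m + 3 * w, m)
    (q + 2 * d + h + 2 * e + (m + 2 * w)) (q + d + h + e + (m + w)).
(* For [q = h = 0], the product of u* and v* only contains weights on a line of direction (-1,2), so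
   this root replaces (1,1). *)
have [qh0|qh_gt0] := posnP (q + h).
  two_witnesses NP (m + 3 * w, m)
    (q + 2 * d + h + 2 * e + (m + 2 * w)) (q + d + h + e + (m + w))
    (m.+2 + 3 * w.-1, m.+2)
    (q + 2 * d + h + 2 * e + (m + 2 * w)) (q + d + h + e + (m + w).+1).
two_witnesses NP (m + 3 * w, m)
    (q + 2 * d + h + 2 * e + (m + 2 * w)) (q + d + h + e + (m + w))
    (m.+1 + 3 * w, m.+1)
    (q + 2 * d + h + 2 * e + (m + 2 * w).+1) (q + d + h + e + (m + w).+1).
Qed.

End Channels.

(** * Symmetries of fusion and lower bounds on the Hom space *)

Lemma mem_Pplus k l : (l \in Pplus k) = in_Pplus k l.
Proof.
case: l => a b; rewrite /in_Pplus /=; apply/allpairsPdep/idP => [[c [e [hc he [-> ->]]]]|h].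
  by move: hc he; rewrite !mem_iota; lia.
by exists a, b; rewrite !mem_iota; split=> //; lia.
Qed.

Lemma fusion_mult_gt0_inv k l m n : 0 < fusion_mult k l m n ->
  [/\ in_Pplus k l, in_Pplus k m, in_Pplus k n & A3 l m n = B3 l m n %[mod 3]].
Proof.
rewrite /fusion_mult; case: ifP => // /and4P[/eqP hA /eqP hB _ hk] _.
move: hk; rewrite !geq_max => /and4P[hl hm hn _].
by split; rewrite ?hA ?hB.
Qed.

(** Both sides count (0,0) in the product of [l], [m] and [n]. *)
Lemma fusion_mult_pair_swap k l m n :
  fusion_mult k l n (conjw m) = fusion_mult k l m (conjw n).
Proof.
have eA : A3 l n (conjw m) = A3 l m (conjw n) by rewrite /A3 /=; lia.
have eB : B3 l n (conjw m) = B3 l m (conjw n) by rewrite /B3 /=; lia.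
rewrite /fusion_mult eA eB; move: (A3 _ _ _) (B3 _ _ _) => a b.
move: (a %/ 3) (b %/ 3) => A B.
rewrite /= [n.1 + n.2]addnC [m.2 + m.1]addnC (maxnCA (n.2 + n.1)).
by rewrite (maxnCA (A - n.1)) [maxn (B - n.2) _]maxnC.
Qed.

Lemma fusion_multC k l m n : fusion_mult k m l n = fusion_mult k l m n.
Proof.
have eA : A3 m l n = A3 l m n by rewrite /A3; lia.
have eB : B3 m l n = B3 l m n by rewrite /B3; lia.
rewrite /fusion_mult eA eB; move: (A3 _ _ _) (B3 _ _ _) => a b.
move: (a %/ 3) (b %/ 3) => A B.
by rewrite (maxnCA (m.1 + m.2)) (maxnCA (A - m.1)) (maxnCA (B - m.2)).
Qed.

Lemma leq_sum2_seq (T : eqType) (s : seq T) (F : T -> nat) a b :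
  a \in s -> b \in s -> a != b -> F a + F b <= \sum_(c <- s) F c.
Proof.
move=> sa sb neq_ab; rewrite (big_rem a) //= leq_add2l (big_rem b) ?leq_addr //.
by move: sb; rewrite (perm_mem (perm_to_rem sa)) inE eq_sym (negPf neq_ab).
Qed.

Lemma leq_sum1_seq (T : eqType) (s : seq T) (F : T -> nat) a :
  a \in s -> F a <= \sum_(c <- s) F c.
Proof. by move=> sa; rewrite (big_rem a) //= leq_addr. Qed.

Lemma two_channels_sum k N1 N2 : two_channels N1 N2 ->
  (forall l, 0 < N1 l -> in_Pplus k l) -> 1 < \sum_(l <- Pplus k) N1 l * N2 l.
Proof.
move=> + NP; case=> [[l [N1l N2l]]|[l [l' [/eqP neq N1l N2l N1l' N2l']]]].
  have l_in : l \in Pplus k by rewrite mem_Pplus NP // ltnW.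
  exact: leq_trans (leq_mul N1l N2l) (leq_sum1_seq _ _ (fun l => N1 l * N2 l) _ l_in).
have [l_in l'_in] : l \in Pplus k /\ l' \in Pplus k by rewrite !mem_Pplus !NP.
apply: leq_trans (leq_add (leq_mul N1l N2l) (leq_mul N1l' N2l')) _.
exact: (leq_sum2_seq _ _ (fun l => N1 l * N2 l)).
Qed.

Lemma two_channels_reindex (f : weight -> weight) (N1 N2 N1' N2' : weight -> nat) :
  injective f -> (forall l, N1' (f l) = N1 l) -> (forall l, N2' (f l) = N2 l) ->
  two_channels N1 N2 -> two_channels N1' N2'.
Proof.
move=> f_inj e1 e2 [[l hl]|[l [l' [neq *]]]]; [left|right].
  by exists (f l); rewrite e1 e2.
by exists (f l), (f l'); rewrite !e1 !e2; split=> // /f_inj.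
Qed.

Lemma conjwK : involutive conjw. Proof. by case. Qed.

(** All terms are nonnegative: keep only [conjw v] in the last product, where it meets [v] in (0,0),
    and [l] in the first. *)
Lemma hom_dim4_ge k l m u v : in_Pplus k l -> in_Pplus k v ->
  \sum_(n <- Pplus k) fusion_mult k l m n * fusion_mult k n u (conjw v)
    <= hom_dim k l [:: m; u; v].
Proof.
move=> kl kv; rewrite /hom_dim /fusion_prod /=.
have unit_v : 1 <= fusion_mult k (conjw v) v (0, 0).
  case: v kv => v1 v2; rewrite /in_Pplus /conjw /= => kv.
  solve_gt0 (v1 + v2) (v1 + v2).
have cv_in : conjw v \in Pplus k by rewrite mem_Pplus /in_Pplus addnC.
have l_in : l \in Pplus k by rewrite mem_Pplus.
apply: leq_trans _ (leq_sum1_seq _ _ _ _ cv_in).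
rewrite -[X in X <= _]muln1; apply: leq_mul => //.
apply: leq_sum => n _; apply: leq_mul => //.
apply: leq_trans _ (leq_sum1_seq _ _ _ _ l_in).
by rewrite /basis eqxx mul1n.
Qed.

Ltac reorder := rewrite /star; apply/idP/idP; [do 7![case/andP => ?]|do 3![case/andP => ?]];
  move=> ?; repeat (apply/andP; split); lia.

(** * The product of (a,b) with its conjugate *)

Section DualSquare.
Variables (k a b : nat).
Let N1 := fusion_mult k (a, b) (b, a).

Lemma dual_square_conj l : N1 (conjw l) = N1 l.
Proof. by rewrite /N1 fusion_multC -(fusion_mult_conj k (a, b) (b, a) l). Qed.

(** [c] is the third affine label. The bounds by [k] supply the conditions on [c], and the result is
    symmetric in [a], [b], [c]. *)
Lemma dual_square_ge c g q d : a + b + c = k -> 0 < g ->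
  (g <= N1 (q + 3 * d, q)) =
  [&& g <= q.+1, d + g <= a.+1, d + g <= b.+1, d + g <= c.+1,
      q + 2 * d + g <= (a + b).+1, q + 2 * d + g <= (a + c).+1,
      q + 2 * d + g <= (b + c).+1 & 2 * q + 3 * d + g <= k.+1].
Proof.
move=> ek g_gt0.
rewrite /N1 (@fusion_mult_geP _ _ _ _ _ (a + b + q + d) (a + b + q + 2 * d)) //=;
  [|rewrite /A3 /=; lia|rewrite /B3 /=; lia].
rewrite ?andbT -?andbA; apply/idP/idP.
  do 26![case/andP => ?]; move=> ?; repeat (apply/andP; split); lia.
do 7![case/andP => ?]; move=> ?; repeat (apply/andP; split); lia.
Qed.

(** [x] and [y] are the two smallest of [a], [b], [c]; [0 < y] because two of these labels vanish
    only for simple currents. *)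
Lemma dual_square_profile : in_Pplus k (a, b) -> ~~ simple_current k (a, b) ->
  exists x y, [/\ x <= y, x + 2 * y <= k, 0 < y & star_profile k x y N1].
Proof.
rewrite /in_Pplus /simple_current /= => kab.
rewrite !negb_or /eq_op /= => nab.
have [c ec] : exists c, a + b + c = k by exists (k - (a + b)); lia.
have profile x y : (forall g q d, 0 < g -> (g <= N1 (q + 3 * d, q)) = star k x y g q d) ->
    star_profile k x y N1.
  move=> H g q d g_gt0; split; first exact: H.
  by rewrite -[N1 _]dual_square_conj; exact: H.
have finish x y : x <= y -> x + 2 * y <= k -> 0 < y ->
    (forall g q d, 0 < g -> [&& g <= q.+1, d + g <= a.+1, d + g <= b.+1, d + g <= c.+1,
      q + 2 * d + g <= (a + b).+1, q + 2 * d + g <= (a + c).+1,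
      q + 2 * d + g <= (b + c).+1 & 2 * q + 3 * d + g <= k.+1] = star k x y g q d) ->
    exists x y, [/\ x <= y, x + 2 * y <= k, 0 < y & star_profile k x y N1].
  move=> lexy leyk y_gt0 H; exists x, y; split=> //.
  by apply: profile => g q d g_gt0; rewrite (dual_square_ge _ _ _ _ ec g_gt0) H.
have [leab|/ltnW leba] := leqP a b; have [lebc|/ltnW lecb] := leqP b c;
  have [leac|/ltnW leca] := leqP a c.
- by apply: (finish a b) => [|||g q d g_gt0]; [lia..|reorder].
- by apply: (finish a b) => [|||g q d g_gt0]; [lia..|reorder].
- by apply: (finish a c) => [|||g q d g_gt0]; [lia..|reorder].
- by apply: (finish c a) => [|||g q d g_gt0]; [lia..|reorder].
- by apply: (finish b a) => [|||g q d g_gt0]; [lia..|reorder].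
- by apply: (finish b c) => [|||g q d g_gt0]; [lia..|reorder].
- by apply: (finish b c) => [|||g q d g_gt0]; [lia..|reorder].
- by apply: (finish c b) => [|||g q d g_gt0]; [lia..|reorder].
Qed.

(** Triality: [A3] and [B3] differ by [j - i], which is thus divisible by 3. *)
Lemma dual_square_weight i j : N1 (i, j) = 1 ->
  exists q d, (i, j) = (q + 3 * d, q) \/ (i, j) = (q, q + 3 * d).
Proof.
move=> h; have /fusion_mult_gt0_inv[_ _ _] : 0 < N1 (i, j) by rewrite h.
rewrite /A3 /B3 /= => tri.
have [leji|leij] := leqP j i.
  by exists j, ((i - j) %/ 3); left; congr pair; lia.
by exists i, ((j - i) %/ 3); right; congr pair; lia.
Qed.

End DualSquare.

(** * Reduction to the chamber cases and conclusion *)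

Definition weight_of (b : bool) q d : weight := if b then (q + 3 * d, q) else (q, q + 3 * d).

Lemma conjw_weight_of b q d : conjw (weight_of b q d) = weight_of (~~ b) q d.
Proof. by case: b. Qed.

Lemma simple_current_weight_of k b q d x y : extremal k x y q d ->
  ~~ simple_current k (weight_of b q d) -> 0 < q + d /\ (q = 0 -> 3 * d < k).
Proof.
move=> /extremalE[[_ [_ le_k]] _]; rewrite /simple_current !negb_or /eq_op.
by case: b => /=; lia.
Qed.

Section DualSquareChannels.
Variables (k a b x y : nat).
Let N := fusion_mult k (a, b) (b, a).
Hypotheses (lexy : x <= y) (leyk : x + 2 * y <= k) (y_gt0 : 0 < y).
Hypothesis NP : star_profile k x y N.
Let channels u v := two_channels N (fun l => fusion_mult k l u (conjw v)).

Lemma channels_sym u v : channels u v -> channels v u.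
Proof.
apply: (two_channels_reindex id) => // l.
exact: fusion_mult_pair_swap.
Qed.

Lemma channels_conj u v : channels (conjw u) (conjw v) -> channels u v.
Proof.
apply: (two_channels_reindex conjw) => [|l|l]; first exact: inv_inj conjwK.
  exact: dual_square_conj.
by rewrite -[in LHS](conjwK u) fusion_mult_conj.
Qed.

(** If [h < q] then [d < e] and u is not extremal; if [2 * h + 3 * e < 2 * q + 3 * d] then [e < d]
    and v is not. So [v* - u] is in the dominant chamber or its image under the first simple
    reflection. *)
Lemma channels_le b' q d h e :
  0 < q + d -> (q = 0 -> 3 * d < k) -> (h = 0 -> 3 * e < k) -> q + d <= h + e ->
  extremal k x y q d -> extremal k x y h e ->
  channels (weight_of true q d) (weight_of b' h e).
Proof.
move=> qd_gt0 qd_ltk he_ltk le_qh ex_u ex_v.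
have [a1 a2] := extremalE _ _ _ _ _ ex_u; have [b1 b2] := extremalE _ _ _ _ _ ex_v.
rewrite /channels conjw_weight_of; case: b' => /=.
  have [le_h|lt_h] := leqP (q + 3 * d) h.
    by apply: (parallel_large k x y N _ _ _ _ q d e h (h - (q + 3 * d))) => //; lia.
  have [le_s|lt_s] := leqP (q + 2 * d) (h + e).
    by apply: (parallel_middle k x y N _ _ _ _ q d e h
      (h + e - (q + 2 * d)) (q + 3 * d - h)) => //; lia.
  by apply: (parallel_small k x y N _ _ _ _ q d e h
      (h + e - (q + d)) (q + 2 * d - (h + e)) (q + 3 * (h + e - (q + d)) - h)) => //; lia.
have [le_de|lt_ed] := leqP d e.
  by apply: (opposite_up k x y N _ _ _ _ q d e h (e - d) (h - q)) => //; lia.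
have [le_h|lt_h] := leqP (q + 3 * (d - e)) h.
  by apply: (opposite_down1 k x y N _ _ _ _ q d e h (d - e) (h - (q + 3 * (d - e)))) => //; lia.
have [le_h'|lt_h'] := leqP (q + 2 * (d - e)) h.
  by apply: (opposite_down2 k x y N _ _ _ _ q d e h
      (h - (q + 2 * (d - e))) (q + 3 * (d - e) - h)) => //; lia.
by apply: (opposite_down3 k x y N _ _ _ _ q d e h
      (2 * h - (2 * q + 3 * (d - e))) (q + 2 * (d - e) - h)) => //; lia.
Qed.

Lemma channels_weight_of b1 b2 q d h e :
  0 < q + d -> (q = 0 -> 3 * d < k) -> 0 < h + e -> (h = 0 -> 3 * e < k) ->
  extremal k x y q d -> extremal k x y h e ->
  channels (weight_of b1 q d) (weight_of b2 h e).
Proof.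
move=> qd_gt0 qd_ltk he_gt0 he_ltk ex_u ex_v.
(* Exchanging u and v orders [q + d] and [h + e]; conjugating both fixes the orientation of the
   smaller one. *)
have [le_qh|/ltnW le_hq] := leqP (q + d) (h + e).
  by case: b1; [|apply: channels_conj; rewrite !conjw_weight_of]; exact: channels_le.
apply: channels_sym.
by case: b2; [|apply: channels_conj; rewrite !conjw_weight_of]; exact: channels_le.
Qed.

Lemma dual_square_extremal i j : N (i, j) = 1 ->
  exists b' q d, (i, j) = weight_of b' q d /\ extremal k x y q d.
Proof.
move=> N1; have [q [d e_ij]] := dual_square_weight _ _ _ _ _ N1.
case: e_ij N1 => -> N1; [exists true|exists false]; exists q, d; split=> //.
  by rewrite /extremal -!(NP _ _ _ _).1 // N1.
by rewrite /extremal -!(NP _ _ _ _).2 // N1.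
Qed.

End DualSquareChannels.

Theorem theorem4p2 (k : nat) (hk : 1 <= k) (a b i j m n : nat) :
  in_Pplus k (a, b) -> ~~ simple_current k (a, b) ->
  in_Pplus k (i, j) -> fusion_mult k (a, b) (b, a) (i, j) = 1 ->
  ~~ simple_current k (i, j) ->
  in_Pplus k (m, n) -> fusion_mult k (a, b) (b, a) (m, n) = 1 ->
  ~~ simple_current k (m, n) ->
  1 < hom_dim k (a, b) [:: (b, a); (i, j); (m, n)].
Proof.
move=> kab nab _ Nij nij kmn Nmn nmn.
apply: leq_trans (hom_dim4_ge k (a, b) (b, a) (i, j) (m, n) kab kmn).
have [x [y [lexy leyk y_gt0 NP]]] := dual_square_profile _ _ _ kab nab.
have [b1 [q [d [eij ex_ij]]]] := dual_square_extremal _ _ _ _ _ NP _ _ Nij.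
have [b2 [h [e [emn ex_mn]]]] := dual_square_extremal _ _ _ _ _ NP _ _ Nmn.
move: nij nmn; rewrite eij emn.
move=> /(simple_current_weight_of _ _ _ _ _ _ ex_ij)[? ?].
move=> /(simple_current_weight_of _ _ _ _ _ _ ex_mn)[? ?].
apply: two_channels_sum; first exact: (channels_weight_of _ _ _ x y).
by move=> l /fusion_mult_gt0_inv[].
Qed.
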